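(* Let $\ell>k\geq 2$ be integers and let $G$ be a $k$-uniform hypergraph on $n$ vertices $V$, partitioned into $\ell$ parts $V_1,\ldots,V_\ell$. Let $\gamma=\ell-\lceil \ell/k\rceil+1$. In $O(n^\gamma)$ time one can create a $\gamma$-uniform hypergraph $G'$ on the same vertex set $V$ such that $G'$ contains an $\ell$-hypercycle if and only if $G$ contains an $\ell$-hyperclique with one node from each $V_i$. Moreover, if the hyperedges of $G$ have weights in $[-W,W]$, then one can assign weights to the hyperedges of $G'$ such that a minimum weight $\ell$-hypercycle in $G'$ corresponds to a minimum weight $\ell$-hyperclique in $G$ (of the same weight), and every hyperedge of $G'$ has weight in $[-\binom{\gamma}{k}W,\binom{\gamma}{k}W]$; in particular $\binom{\gamma}{k}\leq O(\ell^k)$.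
   Context: A $k$-uniform hypergraph has hyperedges that are $k$-element vertex subsets. An $\ell$-hyperclique in a $k$-uniform hypergraph is a set of $\ell$ vertices all of whose $k$-element subsets are hyperedges; its weight is the sum of the weights of these $\binom{\ell}{k}$ hyperedges. An $\ell$-hypercycle in a $\gamma$-uniform hypergraph is an ordered $\ell$-tuple of distinct vertices $v_1,\ldots,v_\ell$ such that for every $i\in\{1,\ldots,\ell\}$, $\{v_i,v_{i+1},\ldots,v_{i+\gamma-1}\}$ (indices mod $\ell$) is a hyperedge; its weight is the sum of the weights of these $\ell$ hyperedges. *)

(* Defs.v *)
From HB Require Import structures.
From mathcomp Require Import all_boot all_order all_algebra.

Set Implicit Arguments.
Unset Strict Implicit.
Unset Printing Implicit Defensive.

Import Order.TTheory GRing.Theory Num.Theory.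

Definition is_bigO (f g : nat -> nat) : Prop :=
  exists c N, forall n, N <= n -> f n <= c * g n.

Definition ceil_div (m d : nat) : nat := (m + d.-1) %/ d.

Definition gamma (l k : nat) : nat := (l - ceil_div l k).+1.

(** * Uniform hypergraphs *)

Record hypergraph (T : finType) (k : nat) := Hypergraph {
  edges :> {set {set T}};
  edges_uniform : forall e, e \in edges -> #|e| = k
}.

Definition hyperclique (T : finType) (k : nat) (G : hypergraph T k) (l : nat)
    (K : {set T}) : Prop :=
  #|K| = l /\ forall e : {set T}, e \subset K -> #|e| = k -> e \in edges G.

(** A partition of the vertices into parts [V_i], [i : 'I_l], is given by the
    function [part] sending a vertex to the index of its part. *)
Definition one_per_part (T : finType) (l : nat) (part : T -> 'I_l)
    (K : {set T}) : Prop :=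
  forall i : 'I_l, #|[set v in K | part v == i]| = 1.

Definition partite_hyperclique (T : finType) (k : nat) (G : hypergraph T k)
    (l : nat) (part : T -> 'I_l) (K : {set T}) : Prop :=
  hyperclique G l K /\ one_per_part part K.

(** [{v_i, v_(i+1), ..., v_(i+g-1)}], indices mod [l] ([ordS] is the cyclic
    successor on ['I_l]). *)
Definition window (T : finType) (l g : nat) (v : l.-tuple T) (i : 'I_l) :
    {set T} :=
  [set tnth v (iter j (@ordS l) i) | j : 'I_g].

Definition hypercycle (T : finType) (g : nat) (G : hypergraph T g) (l : nat)
    (v : l.-tuple T) : Prop :=
  uniq v /\ forall i : 'I_l, window g v i \in edges G.

Section Weights.
Local Open Scope ring_scope.
Variables (T : finType) (R : realDomainType).

Definition hyperclique_weight (k : nat) (w : {set T} -> R) (K : {set T}) : R :=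
  \sum_(e : {set T} | (e \subset K) && (#|e| == k)) w e.

Definition hypercycle_weight (g : nat) (w : {set T} -> R) (l : nat)
    (v : l.-tuple T) : R :=
  \sum_(i < l) w (window g v i).

Definition weights_within (k : nat) (G : hypergraph T k) (w : {set T} -> R)
    (W : R) : Prop :=
  forall e, e \in edges G -> - W <= w e <= W.

Definition min_hyperclique (k : nat) (G : hypergraph T k) (l : nat)
    (part : T -> 'I_l) (w : {set T} -> R) (K : {set T}) : Prop :=
  partite_hyperclique G part K /\
  forall K', partite_hyperclique G part K' ->
    hyperclique_weight k w K <= hyperclique_weight k w K'.

Definition min_hypercycle (g : nat) (G : hypergraph T g) (l : nat)
    (w : {set T} -> R) (v : l.-tuple T) : Prop :=
  hypercycle G v /\
  forall v' : l.-tuple T, hypercycle G v' ->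
    hypercycle_weight g w v <= hypercycle_weight g w v'.

End Weights.

(** * Model of computation

    A word RAM with words of [b] bits, presented as a structured language with
    a cost semantics.  The memory consists of word variables, word arrays, and
    weight arrays with entries in [R]; variables and arrays are named by fixed
    numbers occurring in the program, and array cells are addressed by words.
    Word operations and additions/subtractions of weights have unit cost, and
    weights cannot influence words or control flow. *)

Inductive binop := OAdd | OSub | OMul | ODiv | OMod | OLe | OEq.

Inductive expr :=
| EConst of nat
| EVar of nat
| ERead of nat & expr
| EOp of binop & expr & expr.

Inductive wexpr :=
| WZero
| WRead of nat & expr
| WAdd of wexpr & wexpr
| WSub of wexpr & wexpr.

Inductive cmd :=
| Skip
| Assign of nat & expr
| Store of nat & expr & expr
| WStore of nat & expr & wexpr
| Seq of cmd & cmd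
| If of expr & cmd & cmd
| While of expr & cmd.

Record state (R : zmodType) := State {
  vars : nat -> nat;
  arrs : nat -> nat -> nat;
  warrs : nat -> nat -> R
}.

Definition upd (A : Type) (f : nat -> A) (x : nat) (a : A) : nat -> A :=
  fun y => if y == x then a else f y.

Definition eval_binop (b : nat) (o : binop) (x y : nat) : nat :=
  match o with
  | OAdd => (x + y) %% 2 ^ b
  | OSub => x - y
  | OMul => (x * y) %% 2 ^ b
  | ODiv => x %/ y
  | OMod => x %% y
  | OLe => x <= y
  | OEq => x == y
  end.

Fixpoint eval (R : zmodType) (b : nat) (s : state R) (e : expr) : nat :=
  match e with
  | EConst c => c %% 2 ^ b
  | EVar x => vars s x
  | ERead a i => arrs s a (eval b s i)
  | EOp o e1 e2 => eval_binop b o (eval b s e1) (eval b s e2)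
  end.

Fixpoint weval (R : zmodType) (b : nat) (s : state R) (e : wexpr) : R :=
  match e with
  | WZero => 0%R
  | WRead a i => warrs s a (eval b s i)
  | WAdd e1 e2 => (weval b s e1 + weval b s e2)%R
  | WSub e1 e2 => (weval b s e1 - weval b s e2)%R
  end.

Fixpoint ecost (e : expr) : nat :=
  match e with
  | EConst _ | EVar _ => 1
  | ERead _ i => (ecost i).+1
  | EOp _ e1 e2 => (ecost e1 + ecost e2).+1
  end.

Fixpoint wcost (e : wexpr) : nat :=
  match e with
  | WZero => 1
  | WRead _ i => (ecost i).+1
  | WAdd e1 e2 | WSub e1 e2 => (wcost e1 + wcost e2).+1
  end.

Definition set_var (R : zmodType) (s : state R) (x n : nat) : state R :=
  State (upd (vars s) x n) (arrs s) (warrs s).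

Definition set_arr (R : zmodType) (s : state R) (a i n : nat) : state R :=
  State (vars s) (upd (arrs s) a (upd (arrs s a) i n)) (warrs s).

Definition set_warr (R : zmodType) (s : state R) (a i : nat) (r : R) :
    state R :=
  State (vars s) (arrs s) (upd (warrs s) a (upd (warrs s a) i r)).

(** [exec b c s t s']: with [b]-bit words, [c] started in [s] halts in [s']
    after [t] steps. *)
Inductive exec (R : zmodType) (b : nat) :
    cmd -> state R -> nat -> state R -> Prop :=
| exec_skip s : exec b Skip s 1 s
| exec_assign s x e :
    exec b (Assign x e) s (ecost e).+1 (set_var s x (eval b s e))
| exec_store s a i e :
    exec b (Store a i e) s (ecost i + ecost e).+1
      (set_arr s a (eval b s i) (eval b s e))
| exec_wstore s a i e :
    exec b (WStore a i e) s (ecost i + wcost e).+1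
      (set_warr s a (eval b s i) (weval b s e))
| exec_seq c1 c2 s t1 s1 t2 s2 :
    exec b c1 s t1 s1 -> exec b c2 s1 t2 s2 ->
    exec b (Seq c1 c2) s (t1 + t2) s2
| exec_if_true e c1 c2 s t s' :
    eval b s e != 0 -> exec b c1 s t s' ->
    exec b (If e c1 c2) s (ecost e + t).+1 s'
| exec_if_false e c1 c2 s t s' :
    eval b s e = 0 -> exec b c2 s t s' ->
    exec b (If e c1 c2) s (ecost e + t).+1 s'
| exec_while_true e c s t1 s1 t2 s2 :
    eval b s e != 0 -> exec b c s t1 s1 -> exec b (While e c) s1 t2 s2 ->
    exec b (While e c) s (ecost e + t1 + t2).+1 s2
| exec_while_false e c s :
    eval b s e = 0 -> exec b (While e c) s (ecost e).+1 s.

(** * Representation of hypergraphs in memory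

    A [k]-uniform hypergraph on ['I_n] is stored as its [k]-dimensional
    adjacency table, flattened in base [n]; weights likewise. *)

Definition tuple_index (n : nat) (t : seq 'I_n) : nat :=
  foldr (fun (v : 'I_n) a => v + n * a) 0 t.

Definition stores_edges (n k : nat) (a : nat -> nat) (G : hypergraph 'I_n k) :
    Prop :=
  forall t : k.-tuple 'I_n,
    a (tuple_index t) = ([set x in t] \in edges G).

Definition stores_weights (R : zmodType) (n k : nat) (a : nat -> R)
    (G : hypergraph 'I_n k) (w : {set 'I_n} -> R) : Prop :=
  forall t : k.-tuple 'I_n, [set x in t] \in edges G ->
    a (tuple_index t) = w [set x in t].

(** Memory that is not part of the input has arbitrary contents. *)
Definition input (R : zmodType) (n k l : nat) (G : hypergraph 'I_n k)
    (part : 'I_n -> 'I_l) (s : state R) : Prop :=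
  [/\ vars s 0 = n,
      forall v : 'I_n, arrs s 0 v = part v
    & stores_edges (arrs s 1) G].

Definition weighted_input (R : zmodType) (n k l : nat) (G : hypergraph 'I_n k)
    (part : 'I_n -> 'I_l) (w : {set 'I_n} -> R) (s : state R) : Prop :=
  input G part s /\ stores_weights (warrs s 0) G w.

Definition output (R : zmodType) (n g : nat) (G' : hypergraph 'I_n g)
    (s : state R) : Prop :=
  stores_edges (arrs s 2) G'.

Definition weighted_output (R : zmodType) (n g : nat) (G' : hypergraph 'I_n g)
    (w' : {set 'I_n} -> R) (s : state R) : Prop :=
  output G' s /\ stores_weights (warrs s 1) G' w'.

(** On all inputs satisfying [pre], [p] reaches [post] within [t] steps, for
    every word length [b >= c * log2 (n + 2)]. *)
Definition runs_within (R : zmodType) (p : cmd) (c n t : nat)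
    (pre post : state R -> Prop) : Prop :=
  forall (b : nat) (s : state R), (n + 2) ^ c <= 2 ^ b -> pre s ->
    exists t' s', [/\ exec b p s t' s', t' <= t & post s'].

(* Main.v *)
Require Import Defs.
From HB Require Import structures.
From mathcomp Require Import all_boot all_order all_algebra zify.

Set Implicit Arguments.
Unset Strict Implicit.
Unset Printing Implicit Defensive.

Import Order.TTheory GRing.Theory Num.Theory.

(** Let the hyperedges of [G'] be the [gamma]-sets of vertices whose colours
    form a cyclic arc of [gamma] consecutive parts and all of whose [k]-subsets
    are hyperedges of [G].  Any at most [k] points of a cycle of length [l] lie
    on a common arc of length [gamma]: each point is missed by
    [l - gamma = ceil (l / k) - 1] arcs, and [k (ceil (l / k) - 1) < l].
    Applied to the positions of a hypercycle, for pairs this shows that its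
    vertices have distinct colours, and for [k]-sets that they form a clique.

    For the weights, charge a [k]-set to one arc chosen from its colours, and
    let a hyperedge of [G'] over that arc collect it.  Since the [l] windows of
    a hypercycle have pairwise distinct colour arcs, every arc occurs exactly
    once, so every hyperedge of the clique is counted exactly once.

    The program is a single loop over the [n ^ gamma] cells of the output table
    whose body evaluates expressions of size depending on [l] and [k] only. *)

(** * Arithmetic of [gamma] *)

Lemma ceil_div_bounds l k : 1 < k -> k < l ->
  1 < ceil_div l k <= l /\ k * (ceil_div l k).-1 < l.
Proof.
move=> k_gt1 lt_kl; rewrite /ceil_div.
have k_gt0 : 0 < k by lia.
(* The remainder is at most [k - 1], so [q * k] lies between [l] and [l + k - 1]; both bounds on [q]
   follow. *)
have := divn_eq (l + k.-1) k; have := ltn_pmod (l + k.-1) k_gt0.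
move: (_ %/ k) (_ %% k) => q r r_lt Eq; split; nia.
Qed.

Lemma gamma_lt l k : 1 < k -> k < l -> gamma l k < l.
Proof. by move=> k1 kl; have [] := ceil_div_bounds k1 kl; rewrite /gamma; lia. Qed.

Lemma mul_sub_gamma_lt l k : 1 < k -> k < l -> k * (l - gamma l k) < l.
Proof.
move=> k1 kl; have [/andP[h1 h2] h3] := ceil_div_bounds k1 kl.
by have -> : l - gamma l k = (ceil_div l k).-1 by rewrite /gamma; lia.
Qed.

(** Pascal's rule and induction: [m ^ k.+1 + m ^ k = m.+1 * m ^ k]. *)
Lemma bin_le_exp m k : 'C(m, k) <= m ^ k.
Proof.
elim: m k => [|m IHm] [|k] //; rewrite binS.
apply: leq_trans (leq_add (IHm _) (IHm _)) _.
rewrite expnS addnC -mulSn expnS; apply: leq_mul => //.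
by case: k => [|k] //; rewrite leq_exp2r.
Qed.

(** * Arcs of the cyclic order *)

Section Arcs.
Variables (l g : nat).
Implicit Types (a c : 'I_l) (C : {set 'I_l}).

Definition cyc_arc a : {set 'I_l} := [set iter j (@ordS l) a | j : 'I_g].

Lemma val_iter_ordS j a : val (iter j (@ordS l) a) = (a + j) %% l.
Proof.
elim: j => [|j IHj] /=; first by rewrite addn0 modn_small.
by rewrite IHj -addn1 modnDml addn1 addnS.
Qed.

Lemma iter_ordSP a c : exists2 j, j < l & c = iter j (@ordS l) a.
Proof.
have l_gt0 : 0 < l by case: (l) a => [[]|].
(* This is [c - a] modulo [l], written so that the subtraction is not truncated. *)
exists ((c + (l - a)) %% l); first by rewrite ltn_mod.
apply: val_inj; rewrite val_iter_ordS modnDmr addnCA subnKC; last exact: ltnW.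
by rewrite modnDr modn_small.
Qed.

Lemma iter_ordS_inj a (i j : nat) :
  i < l -> j < l -> iter i (@ordS l) a = iter j (@ordS l) a -> i = j.
Proof.
move=> li lj /(congr1 val); rewrite !val_iter_ordS => /eqP.
by rewrite eqn_modDl !modn_small // => /eqP.
Qed.

Lemma iter_ordSK a : iter l (@ordS l) a = a.
Proof. by apply: val_inj; rewrite val_iter_ordS modnDr modn_small. Qed.

Lemma mem_cyc_arc a j : j < l -> (iter j (@ordS l) a \in cyc_arc a) = (j < g).
Proof.
move=> lj; apply/imsetP/idP => [[i _ Eji]|lt_jg]; last by exists (Ordinal lt_jg).
case: (ltnP i l) => [li|li]; last by have := ltn_ord i; lia.
by rewrite (iter_ordS_inj lj li Eji) ltn_ord.
Qed.

Lemma card_cyc_arc a : g <= l -> #|cyc_arc a| = g.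
Proof.
move=> le_gl; rewrite card_imset ?card_ord // => i j Eij.
by apply: val_inj; apply: (@iter_ordS_inj a) Eij; apply: leq_trans le_gl.
Qed.

(** The start of an arc is its only point whose predecessor is off the arc. If [b] came later on the
    arc from [a], its predecessor would be on that arc too, yet it is the iterate [l.-1] of [b], and
    [l.-1 >= g]. *)
Lemma cyc_arc_inj : 0 < g < l -> injective cyc_arc.
Proof.
case/andP=> g_gt0 lt_gl a b Eab; have [[|d] ld Eb] := iter_ordSP a b.
  by rewrite Eb.
have l_gt0 : 0 < l by lia.
have : b \in cyc_arc a.
  by rewrite Eab -[b in b \in _]/(iter 0 (@ordS l) b) mem_cyc_arc.
rewrite Eb mem_cyc_arc // => lt_dg.
have : iter d (@ordS l) a \in cyc_arc b by rewrite -Eab mem_cyc_arc; lia.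
have -> : iter d (@ordS l) a = iter l.-1 (@ordS l) b.
  rewrite Eb -iterD (_ : l.-1 + d.+1 = d + l); last by lia.
  by rewrite iterD iter_ordSK.
by rewrite mem_cyc_arc; lia.
Qed.

(* The start points [c + j], [c \in C], [0 < j <= l - g], of the arcs that miss
   a point of [C] are too few to exhaust the cycle. *)
Lemma sub_cyc_arc C : #|C| * (l - g) < l -> exists a, C \subset cyc_arc a.
Proof.
move=> ltCl.
pose start (p : 'I_l * 'I_(l - g)) := iter p.2.+1 (@ordS l) p.1.
have : start @: setX C setT != setT.
  apply/eqP=> badT; have := leq_imset_card start (setX C setT).
  by rewrite badT cardsX !cardsT !card_ord leqNgt ltCl.
rewrite -subTset; case/subsetPn => a _ a_good; exists a; apply/subsetP=> c Cc.
have [j lj Ec] := iter_ordSP a c; rewrite Ec mem_cyc_arc //.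
rewrite ltnNge; apply: contra a_good => le_gj.
(* Going round from [c], which is [j] steps after [a], returns to [a] after [l - j] steps; [start]
   supplies one of them. *)
have lt_jg : l - j.+1 < l - g by lia.
apply/imsetP; exists (c, Ordinal lt_jg); first by rewrite !inE Cc.
have El : (l - j.+1).+1 + j = l by lia.
by rewrite Ec /start -iterD [_ + j]El iter_ordSK.
Qed.

(** This lets the facts about arcs apply to positions on a hypercycle as well as to colours. *)
Lemma windowE (T : finType) (v : l.-tuple T) i :
  window g v i = tnth v @: cyc_arc i.
Proof. by rewrite /window /cyc_arc -imset_comp. Qed.

End Arcs.

(** * The hypergraph of cliques over an arc *)

Section CycleGraph.
Variables (T : finType) (k l g : nat) (G : hypergraph T k) (part : T -> 'I_l).
Implicit Types (S e K : {set T}) (C : {set 'I_l}).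

Definition arc_clique (S : {set T}) : bool :=
  [&& #|S| == g, [exists a, part @: S == cyc_arc g a]
    & [forall e : {set T}, (e \subset S) && (#|e| == k) ==> (e \in edges G)]].

Lemma arc_clique_uniform S : S \in [set S | arc_clique S] -> #|S| = g.
Proof. by rewrite inE => /and3P[/eqP]. Qed.

Definition cycle_graph : hypergraph T g := Hypergraph arc_clique_uniform.

(* The arc to which the weight of a hyperedge with colour set [C] is charged. *)
Definition home (C : {set 'I_l}) : {set 'I_l} :=
  if [pick a | C \subset cyc_arc g a] is Some a then cyc_arc g a else set0.

Definition arc_weight (R : zmodType) (w : {set T} -> R) (S : {set T}) : R :=
  (\sum_(e : {set T} |
     (e \subset S) && (#|e| == k) && (home (part @: e) == part @: S)) w e)%R.

Hypothesis g_bounds : 0 < g < l.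
Hypothesis k_gt1 : 1 < k.
Hypothesis cover : k * (l - g) < l.

Let card_sub_cyc_arc C :
  #|C| <= k -> exists a, C \subset cyc_arc g a.
Proof.
by move=> leCk; apply/sub_cyc_arc/leq_ltn_trans/cover/leq_mul.
Qed.

Lemma cycle_edgeP S : reflect
  [/\ #|S| = g, exists a, part @: S = cyc_arc g a
    & forall e : {set T}, e \subset S -> #|e| = k -> e \in edges G]
  (S \in edges cycle_graph).
Proof.
rewrite inE; apply: (iffP and3P) => [[/eqP cS /existsP[a /eqP Ea] /forallP cl]|
  [cS [a Ea] cl]]; split; rewrite ?cS //.
- by exists a.
- by move=> e eS ce; have := cl e; rewrite eS ce eqxx.
- by apply/existsP; exists a; rewrite Ea.
- by apply/forallP=> e; apply/implyP=> /andP[eS /eqP ce]; apply: cl.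
Qed.

(** The colour set of [S] is an arc, so it has [g] elements, as many as [S] itself. *)
Lemma cycle_edge_inj S : S \in edges cycle_graph -> {in S &, injective part}.
Proof.
case/cycle_edgeP=> cS [a Ea] _; apply/imset_injP.
by rewrite Ea card_cyc_arc ?cS //; case/andP: g_bounds => _ /ltnW.
Qed.

(** The covering property ensures that the default [set0] of [home] is never reached here. *)
Lemma homeP C : #|C| <= k ->
  exists2 a, home C = cyc_arc g a & C \subset cyc_arc g a.
Proof.
move=> leCk; rewrite /home; case: pickP => [a Ca|none]; first by exists a.
by have [a] := card_sub_cyc_arc leCk; rewrite none.
Qed.

(** * From hypercycles to hypercliques *)

Section OfHypercycle.
Variable v : l.-tuple T.
Hypothesis hv : hypercycle cycle_graph v.

Let K := [set x in v].

Let v_inj : injective (tnth v).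
Proof. by apply/tuple_uniqP; case: hv. Qed.

Let in_K x : x \in K -> exists i, x = tnth v i.
Proof. by rewrite inE => /tnthP. Qed.

Let window_sub i : window g v i \subset K.
Proof. by apply/subsetP=> x /imsetP[j _ ->]; rewrite inE mem_tnth. Qed.

Lemma hypercycle_card : #|K| = l.
Proof. by rewrite cardsE (card_uniqP _) ?size_tuple; case: hv. Qed.

Lemma hypercycle_part_inj : {in K &, injective part}.
Proof.
move=> x y /in_K[i ->] /in_K[j ->] Eij.
(* Since [2 <= k], two positions lie in a common window, on which colours are injective. *)
have [|a] := @card_sub_cyc_arc [set i; j].
  by rewrite cards2; case: (_ != _); lia.
rewrite subUset !sub1set => /andP[ia ja].
apply: (@cycle_edge_inj (window g v a)) Eij; rewrite ?windowE ?imset_f //.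
by rewrite -windowE; case: hv.
Qed.

(** The covering property is applied to the positions of [e] on the cycle, not to its colours. *)
Lemma hypercycle_sub_window e : e \subset K -> #|e| <= k ->
  exists i, e \subset window g v i.
Proof.
move=> eK cek; have [|a aC] := @card_sub_cyc_arc (tnth v @^-1: e).
  rewrite -(card_imset _ v_inj); apply: leq_trans cek; apply: subset_leq_card.
  by apply/subsetP=> x /imsetP[i]; rewrite inE => ei ->.
exists a; rewrite windowE; apply/subsetP=> x ex.
have [i Ex] := in_K (subsetP eK x ex); rewrite Ex imset_f //.
by apply: (subsetP aC); rewrite inE -Ex.
Qed.

Lemma hypercycle_clique : partite_hyperclique G part K.
Proof.
split; first split; first exact: hypercycle_card.
  move=> e eK ce; have [|i ei] := hypercycle_sub_window eK; first by rewrite ce.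
  have [_ /(_ i) /cycle_edgeP[_ _ cl]] := hv; exact: cl.
move=> i; have : i \in part @: K.
  suff -> : part @: K = setT by rewrite inE.
  apply/eqP; rewrite eqEcard subsetT cardsT card_ord.
  by rewrite (card_in_imset hypercycle_part_inj) hypercycle_card leqnn.
case/imsetP=> x Kx Ei; apply/eqP/cards1P; exists x; apply/setP=> y.
rewrite in_set in_set1; apply/andP/eqP => [[Ky /eqP Ey]|->]; last by rewrite Ei.
by apply: hypercycle_part_inj => //; rewrite Ey.
Qed.


Lemma hypercycle_part_sub (A B : {set T}) : A \subset K -> B \subset K ->
  (part @: A \subset part @: B) = (A \subset B).
Proof.
move=> AK BK; apply/idP/idP => [sAB|]; last exact: imsetS.
apply/subsetP=> x Ax; have /imsetP[y By Exy] := subsetP sAB _ (imset_f part Ax).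
by rewrite (hypercycle_part_inj (subsetP AK _ Ax) (subsetP BK _ By) Exy).
Qed.

(** Windows over the same colour arc coincide because colours are injective on [K]; then their
    position arcs coincide, and so do the starts of these. Hence [f] is injective on a finite
    type. *)
Lemma hypercycle_arcs : exists2 f : 'I_l -> 'I_l, bijective f &
  forall i, part @: window g v i = cyc_arc g (f i).
Proof.
have exa i : exists a, part @: window g v i == cyc_arc g a.
  by have [_ /(_ i) /cycle_edgeP[_ [a Ea] _]] := hv; exists a; rewrite Ea.
pose f i := xchoose (exa i).
have fP i : part @: window g v i = cyc_arc g (f i).
  by apply/eqP/(xchooseP (exa i)).
exists f => //; apply: injF_bij => i j Eij.
apply: (cyc_arc_inj g_bounds); apply: (imset_inj v_inj); rewrite -!windowE.
have sub a b : f a = f b -> window g v a \subset window g v b.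
  by move=> Eab; rewrite -hypercycle_part_sub // !fP Eab.
by apply/eqP; rewrite eqEsubset !sub.
Qed.

Lemma hypercycle_weightE (R : realDomainType) (w : {set T} -> R) :
  hypercycle_weight g (arc_weight w) v = hyperclique_weight k w K.
Proof.
rewrite /hypercycle_weight /hyperclique_weight.
have [f f_bij fP] := hypercycle_arcs.
pose P e := (e \subset K) && (#|e| == k).
(* Windows are renamed by their colour arcs. The test that [e] lies in the window disappears: if the
   home of [e] is that colour arc, the colours of [e] lie in it, hence [e] lies in the window. *)
transitivity
  (\sum_(i < l) \sum_(e | P e && (home (part @: e) == cyc_arc g i)) w e)%R.
  rewrite [RHS](reindex f); last exact: onW_bij.
  apply: eq_bigr => i _; apply: eq_bigl => e; rewrite fP.
  rewrite /P -!andbA; case: (#|e| =P k) => ce; rewrite ?andbF //=.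
  case: (home _ =P _) => He; rewrite ?andbF ?andbT //.
  apply/idP/idP => [/subset_trans-> //|eK].
  rewrite -hypercycle_part_sub // fP -He.
  by have [|a -> //] := @homeP (part @: e); rewrite -ce leq_imset_card.
(* After the exchange, each [e] contributes only at the start of its home arc. *)
rewrite (exchange_big_dep P) /=; last by move=> i e _ /andP[].
apply: eq_bigr => e Pe; have [_ /eqP ce] := andP Pe.
have [|a Ha _] := @homeP (part @: e); first by rewrite -ce leq_imset_card.
rewrite (big_pred1 a) // => i; rewrite Pe Ha /=.
by rewrite eq_sym (inj_eq (cyc_arc_inj g_bounds)).
Qed.

End OfHypercycle.

(** The clique is traversed in the order of its colours, so that the window at [i] has colour set
    [cyc_arc g i]. *)
Lemma clique_hypercycle K : partite_hyperclique G part K ->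
  exists2 v : l.-tuple T, [set x in v] = K & hypercycle cycle_graph v.
Proof.
case=> [[cK clK] oneK].
have exx i : exists x, (x \in K) && (part x == i).
  have /eqP/cards1P[x /setP/(_ x)] := oneK i.
  by rewrite in_set in_set1 eqxx => xK; exists x.
pose x i := xchoose (exx i).
have xK i : x i \in K by case/andP: (xchooseP (exx i)).
have px i : part (x i) = i by case/andP: (xchooseP (exx i)) => _ /eqP.
have x_inj : injective x by move=> i j Eij; rewrite -(px i) Eij px.
pose v := [tuple x i | i < l].
have vE i : tnth v i = x i by rewrite tnth_mktuple.
have uv : uniq v by apply/tuple_uniqP => i j; rewrite !vE => /x_inj.
have EK : [set x in v] = K.
  apply/eqP; rewrite eqEcard cK cardsE (card_uniqP uv) size_tuple leqnn andbT.
  by apply/subsetP=> y; rewrite inE => /tnthP[i ->]; rewrite vE.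
exists v => //; split=> // i; have wE : window g v i = x @: cyc_arc g i.
  by rewrite windowE; apply: eq_imset => j; rewrite vE.
apply/cycle_edgeP; rewrite wE; split.
- by rewrite card_imset // card_cyc_arc //; case/andP: g_bounds => _ /ltnW.
- by exists i; rewrite -imset_comp -[RHS]imset_id; apply: eq_imset => j /=.
- move=> e /subset_trans sub; apply/clK/sub.
  by apply/subsetP=> y /imsetP[j _ ->].
Qed.

Lemma arc_weight_within (R : realDomainType) (w : {set T} -> R) (W : R) :
  weights_within G w W ->
  weights_within cycle_graph (arc_weight w) ('C(g, k)%:R * W)%R.
Proof.
move=> hw S /cycle_edgeP[cS _ cl].
have <- : #|[set e : {set T} | e \subset S & #|e| == k]| = 'C(g, k).
  by rewrite cards_draws cS.
rewrite /arc_weight big_mkcondr /= mulr_natl.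
rewrite -mulNrn -!sumr_const !big_set /=.
have hwe e : (e \subset S) && (#|e| == k) ->
    (- W <= (if home (part @: e) == part @: S then w e else 0) <= W)%R.
  case/andP=> eS /eqP ce; have /andP[W1 W2] := hw e (cl e eS ce).
  case: ifP => _; first by rewrite W1.
  (* A [k]-set charged elsewhere contributes [0]; the bounds [- W <= w e <= W] give [0 <= W]. *)
  rewrite oppr_le0 andbb; have := le_trans W1 W2.
  by rewrite -subr_ge0 opprK -mulr2n pmulrn_lge0.
by apply/andP; split; apply: ler_sum => e /hwe/andP[].
Qed.

End CycleGraph.

(** * Subsets of a duplicate-free tuple as bit masks *)

(** Masks depend on [g] and [k] only, so the enumeration of [k]-subsets can be unrolled in the
    program text. *)
Definition masks (g k : nat) : seq (g.-tuple bool) :=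
  [seq m : g.-tuple bool <- enum {: g.-tuple bool} | count id m == k].

Section Masks.
Variables (T : finType) (g k : nat) (t : g.-tuple T).
Hypothesis t_uniq : uniq t.

Let subset_of (m : g.-tuple bool) : {set T} := [set x in mask m t].
Let mask_of (e : {set T}) : g.-tuple bool := [tuple of [seq x \in e | x <- t]].

Let mask_ofK (e : {set T}) : e \subset [set x in t] -> subset_of (mask_of e) = e.
Proof.
move=> et; apply/setP=> x; rewrite inE /= -filter_mask mem_filter.
by case ex: (x \in e) => //=; have := subsetP et x ex; rewrite inE.
Qed.

Let subset_ofK : cancel subset_of mask_of.
Proof.
move=> m; apply: eq_from_tnth => i; rewrite tnth_map inE in_mask // mem_tnth /=.
rewrite [RHS](tnth_nth false) [tnth t i](tnth_nth (tnth t i)).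
by rewrite index_uniq ?size_tuple.
Qed.

Let card_subset_of m : #|subset_of m| = count id m.
Proof.
rewrite cardsE (card_uniqP _) ?mask_uniq //.
by rewrite size_mask // !size_tuple.
Qed.

Let subset_of_sub m : subset_of m \subset [set x in t].
Proof. by apply/subsetP=> x; rewrite !inE => /mem_mask. Qed.

Lemma sum_masks (R : zmodType) (F : {set T} -> R) :
  (\sum_(e : {set T} | (e \subset [set x in t]) && (#|e| == k)) F e =
   \sum_(m <- masks g k) F [set x in mask m t])%R.
Proof.
rewrite big_filter big_enum_cond (reindex subset_of) /=.
  by apply: eq_bigl => m; rewrite subset_of_sub card_subset_of.
exists mask_of => [m _|e]; first exact: subset_ofK.
by rewrite inE => /andP[/mask_ofK].
Qed.

Lemma all_masks (P : pred {set T}) :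
  all (fun m : g.-tuple bool => P [set x in mask m t]) (masks g k) =
  [forall e : {set T}, (e \subset [set x in t]) && (#|e| == k) ==> P e].
Proof.
apply/allP/forallP => [allP e|allP m].
  apply/implyP=> /andP[et /eqP ce]; rewrite -(mask_ofK et); apply: allP.
  by rewrite mem_filter mem_enum andbT -card_subset_of mask_ofK ?ce.
rewrite mem_filter => /andP[cm _]; have := allP (subset_of m).
by rewrite subset_of_sub card_subset_of cm.
Qed.

End Masks.

(** * Expressions *)

(** Truth values are [0] and [1]. Truncated subtraction then gives negation, and conjunction as
    [e1 - (1 - e2)]. *)
Definition ENot e := EOp OSub (EConst 1) e.
Definition EAnd e1 e2 := EOp OSub e1 (ENot e2).
Definition EOr e1 e2 := EOp OLe (ENot e1) e2.
Definition EAll := foldr EAnd (EConst 1).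
Definition EAny := foldr EOr (EConst 0).
Definition ESel c e1 e2 := EOp OAdd (EOp OMul c e1) (EOp OMul (ENot c) e2).
Definition EPow j := iter j (EOp OMul (EVar 0)) (EConst 1).
Definition EIndex :=
  foldr (fun e acc => EOp OAdd e (EOp OMul (EVar 0) acc)) (EConst 0).
(** Variable 0 holds [n]; variable 1, the loop counter, is read as the base-[n] index of the current
    tuple. *)
Definition EDigit j := EOp OMod (EOp ODiv (EVar 1) (EPow j)) (EVar 0).

(* Tabulates [P]: a disjunction over all value sequences satisfying [P]. *)
Fixpoint EDecide (l : nat) (P : pred (seq 'I_l)) (es : seq expr) : expr :=
  if es is e :: es' then
    EAny (map (fun a : 'I_l =>
      EAnd (EOp OEq e (EConst a)) (EDecide (fun s => P (a :: s)) es'))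
      (enum 'I_l))
  else EConst (P [::]).

Lemma tuple_index_lt n (u : seq 'I_n) : tuple_index u < n ^ size u.
Proof.
elim: u => [|x u IHu] //=; rewrite expnS -/(tuple_index u).
have := ltn_ord x; nia.
Qed.

Lemma tuple_index_digit n (u : seq 'I_n) :
  [seq tuple_index u %/ n ^ j %% n | j <- iota 0 (size u)] = map val u.
Proof.
elim: u => [|x u IHu] //=; have n_gt0 : 0 < n := leq_ltn_trans (leq0n x) (ltn_ord x).
rewrite -/(tuple_index u) (addnC x) (mulnC n).
rewrite expn0 divn1 modnMDl modn_small //; congr (_ :: _).
rewrite -IHu (iotaDl 1 0) -map_comp; apply: eq_map => j /=.
by rewrite expnS divnMA divnMDl // [x %/ n]divn_small ?addn0.
Qed.

(** * Evaluation of the expressions *)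

Section Eval.
Variables (R : zmodType) (b : nat) (s : state R).
Hypothesis b_gt0 : 0 < b.
Local Notation ev := (eval b s).

Let b_gt1 : 1 < 2 ^ b. Proof. by rewrite -[1]/(2 ^ 0) ltn_exp2l. Qed.

Lemma eval_const c : c < 2 ^ b -> ev (EConst c) = c.
Proof. exact: modn_small. Qed.

Lemma eval_bool (x : bool) : ev (EConst x) = x.
Proof. by apply: eval_const; apply: leq_ltn_trans b_gt1; case: x. Qed.

Lemma eval_not (x : bool) e : ev e = x -> ev (ENot e) = ~~ x.
Proof. by move=> /= ->; rewrite modn_small //; case: x. Qed.

Lemma eval_and (x y : bool) e1 e2 :
  ev e1 = x -> ev e2 = y -> ev (EAnd e1 e2) = x && y.
Proof.
move=> E1 /eval_not E2; rewrite /EAnd -[LHS]/(ev e1 - ev (ENot e2)) E1 E2.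
by case: x y {E1 E2} => [] [].
Qed.

Lemma eval_or (x y : bool) e1 e2 :
  ev e1 = x -> ev e2 = y -> ev (EOr e1 e2) = x || y.
Proof.
move=> /eval_not E1 E2; rewrite /EOr -[LHS]/(nat_of_bool (ev (ENot e1) <= ev e2)).
by rewrite E1 E2; case: x y {E1 E2} => [] [].
Qed.

Lemma eval_all (I : eqType) (f : I -> expr) (p : pred I) (r : seq I) :
  {in r, forall i, ev (f i) = p i} -> ev (EAll (map f r)) = all p r.
Proof.
elim: r => [|i r IHr] fr; first exact: (eval_bool true).
by apply: eval_and; [rewrite fr ?mem_head|apply: IHr => j jr; rewrite fr // mem_behead].
Qed.

Lemma eval_any (I : eqType) (f : I -> expr) (p : pred I) (r : seq I) :
  {in r, forall i, ev (f i) = p i} -> ev (EAny (map f r)) = has p r.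
Proof.
elim: r => [|i r IHr] fr; first exact: (eval_bool false).
by apply: eval_or; [rewrite fr ?mem_head|apply: IHr => j jr; rewrite fr // mem_behead].
Qed.

Lemma eval_decide l (P : pred (seq 'I_l)) es (cs : seq 'I_l) :
  l < 2 ^ b -> map ev es = map val cs -> ev (EDecide P es) = P cs.
Proof.
move=> lb; elim: es cs P => [|e es IHes] [|c cs] P //; first by rewrite eval_bool.
move=> [Ee Ees]; rewrite (@eval_any _ _ (fun a => (c == a) && P (a :: cs))).
  congr (nat_of_bool _); apply/hasP/idP => [[a _ /andP[/eqP<-]] //|Pc].
  by exists c; rewrite ?mem_enum ?eqxx.
move=> a _; apply: eval_and; last exact: IHes.
by rewrite -[LHS]/(nat_of_bool (ev e == ev (EConst a))) Ee eval_const // (ltn_trans _ lb).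
Qed.

Lemma eval_sel (x : bool) c e1 e2 : ev c = x -> ev e1 < 2 ^ b -> ev e2 < 2 ^ b ->
  ev (ESel c e1 e2) = if x then ev e1 else ev e2.
Proof.
move=> Ec lt1 lt2.
rewrite -[LHS]/(((ev c * ev e1) %% 2 ^ b + (ev (ENot c) * ev e2) %% 2 ^ b) %% 2 ^ b).
rewrite Ec (eval_not Ec); case: x {Ec}; rewrite /= mul1n mul0n mod0n ?addn0 ?add0n;
by rewrite !modn_small.
Qed.

Variable n : nat.
Hypothesis s_n : vars s 0 = n.

Lemma eval_pow j : n ^ j < 2 ^ b -> ev (EPow j) = n ^ j.
Proof.
elim: j => [|j IHj] lb; first exact: eval_const.
rewrite -[LHS]/((vars s 0 * ev (EPow j)) %% 2 ^ b) s_n.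
(* For [n = 0] the bound on [n ^ j.+1] does not bound [n ^ j], but the product vanishes whatever the
   other factor is. *)
case: (posnP n) => [->|n_gt0]; first by rewrite mul0n mod0n exp0n.
rewrite IHj -?expnS ?modn_small //.
by apply: leq_ltn_trans lb; rewrite leq_pexp2l.
Qed.

Lemma eval_index es (u : seq 'I_n) : n ^ size u < 2 ^ b ->
  map ev es = map val u -> ev (EIndex es) = tuple_index u.
Proof.
elim: es u => [|e es IHes] [|x u] // lb; first by move=> _; apply: mod0n.
move=> [Ee Ees]; have n_gt0 : 0 < n := leq_ltn_trans (leq0n x) (ltn_ord x).
rewrite -[LHS]/((ev e + (vars s 0 * ev (EIndex es)) %% 2 ^ b) %% 2 ^ b).
have lb' : n ^ size u < 2 ^ b.
  by apply: leq_ltn_trans lb; rewrite leq_pexp2l /=.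
rewrite (IHes u) // s_n Ee; have := tuple_index_lt (x :: u).
rewrite /= -/(tuple_index u) => /ltn_trans/(_ lb) lt.
by rewrite [(n * _) %% _]modn_small ?modn_small //; apply: leq_ltn_trans lt; apply: leq_addl.
Qed.

End Eval.

(** * The program *)

Lemma exec_for (R : zmodType) b (Inv : nat -> state R -> Prop) e c N tc :
    (forall i s, Inv i s -> eval b s e = (i < N)) ->
    (forall i s, i < N -> Inv i s ->
       exists2 s', exec b c s tc s' & Inv i.+1 s') ->
  forall s, Inv 0 s ->
  exists2 s', exec b (While e c) s (N * (ecost e + tc).+1 + (ecost e).+1) s'
            & Inv N s'.
Proof.
move=> test step s Inv0.
(* Induction on the number [d] of remaining iterations; the last summand pays for the failing
   test. *)
suff loop d i s1 : i + d = N -> Inv i s1 ->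
    exists2 s', exec b (While e c) s1 (d * (ecost e + tc).+1 + (ecost e).+1) s'
              & Inv N s' by exact: (loop N 0).
elim: d i s1 {Inv0} => [|d IHd] i s1 Ni Invi.
  have Ei : i = N by lia.
  exists s1; last by rewrite -Ei.
  by apply: exec_while_false; rewrite (test _ _ Invi) Ei ltnn.
have lt_iN : i < N by lia.
have [s2 ex2 Inv2] := step i s1 lt_iN Invi.
have [|s3 ex3 Inv3] := IHd i.+1 s2 _ Inv2; first by lia.
exists s3 => //; rewrite mulSn -addnA addSn.
by apply: exec_while_true ex2 ex3; rewrite (test _ _ Invi) lt_iN.
Qed.

Section Program.
Variables (l k g : nat).

Definition digits := map EDigit (iota 0 g).
Definition colours := map (ERead 0) digits.

Definition arc_colours (cs : seq 'I_l) : bool :=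
  uniq cs && [exists a, [set c in cs] == cyc_arc g a].

Definition charged (m : seq bool) (cs : seq 'I_l) : bool :=
  home g [set c in mask m cs] == [set c in cs].

Definition edge_expr : expr :=
  EAnd (EDecide arc_colours colours)
    (EAll [seq ERead 1 (EIndex (mask m digits)) | m : g.-tuple bool <- masks g k]).

(* Weight expressions have no conditional: a hyperedge charged elsewhere is
   replaced by cell [n ^ k], which no [k]-tuple uses and which holds [0]. *)
Definition weight_expr : wexpr :=
  foldr WAdd WZero
    [seq WRead 0 (ESel (EDecide (charged m) colours)
                    (EIndex (mask m digits)) (EPow k))
      | m : g.-tuple bool <- masks g k].

Definition loop_test : expr := ENot (EOp OLe (EPow g) (EVar 1)).

Definition loop_body : cmd :=
  Seq (Store 2 (EVar 1) edge_expr)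
    (Seq (WStore 1 (EVar 1) weight_expr)
      (Assign 1 (EOp OAdd (EVar 1) (EConst 1)))).

Definition program : cmd :=
  Seq (Assign 1 (EConst 0)) (Seq (WStore 0 (EPow k) WZero)
    (While loop_test loop_body)).

(** The body has no branches, so its cost is exact; the [4] pays for incrementing the counter. *)
Definition body_cost : nat :=
  (1 + ecost edge_expr).+1 + ((1 + wcost weight_expr).+1 + 4).

Definition program_time (n : nat) : nat :=
  2 + ((ecost (EPow k) + 1).+1 +
    (n ^ g * (ecost loop_test + body_cost).+1 + (ecost loop_test).+1)).

Lemma program_time_bigO : 0 < g -> is_bigO program_time (fun n => n ^ g).
Proof.
move=> g_gt0; rewrite /is_bigO /program_time.
exists (2 + ((ecost (EPow k) + 1).+1 +
  ((ecost loop_test + body_cost).+1 + (ecost loop_test).+1))), 1 => n n_gt0.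
have : 0 < n ^ g by rewrite expn_gt0 n_gt0.
by move: (n ^ g) (ecost _) (ecost _) body_cost => N c1 c2 c3 N_gt0; nia.
Qed.

(** * Correctness of the program *)

Variables (n : nat) (G : hypergraph 'I_n k) (part : 'I_n -> 'I_l).
Local Notation G' := (cycle_graph g G part).

Variables (R : zmodType) (b : nat).
Hypothesis l_small : l < 2 ^ b.
Hypothesis k_small : n ^ k < 2 ^ b.
Hypothesis g_small : n ^ g < 2 ^ b.
Hypothesis b_gt0 : 0 < b.

Record ready (s : state R) : Prop := Ready {
  ready_n : vars s 0 = n;
  ready_part : forall v : 'I_n, arrs s 0 v = part v;
  ready_edges : stores_edges (arrs s 1) G;
  ready_zero : warrs s 0 (n ^ k) = 0%R
}.

Section AtTuple.
Variables (s : state R) (t : g.-tuple 'I_n).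
Hypothesis s_ready : ready s.
Hypothesis s_t : vars s 1 = tuple_index t.

Lemma eval_digits : map (eval b s) digits = map val t.
Proof.
rewrite -tuple_index_digit size_tuple -map_comp.
apply/eq_in_map => j; rewrite mem_iota => /andP[_ lt_jg].
rewrite /comp -[LHS]/((vars s 1 %/ eval b s (EPow j)) %% vars s 0).
rewrite s_t (eval_pow b_gt0 (ready_n s_ready)) ?(ready_n s_ready) //.
have n_gt0 : 0 < n.
  exact: leq_ltn_trans (leq0n _) (ltn_ord (tnth t (Ordinal lt_jg))).
by apply: leq_ltn_trans g_small; rewrite leq_pexp2l // ltnW.
Qed.

Lemma eval_colours : map (eval b s) colours = map val (map part t).
Proof.
transitivity (map (arrs s 0) (map (eval b s) digits)).
  by rewrite /colours -!map_comp.
by rewrite eval_digits -!map_comp; apply: eq_map => v; apply: ready_part.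
Qed.

Lemma eval_mask_index m : m \in masks g k ->
  eval b s (EIndex (mask m digits)) = tuple_index (mask m t).
Proof.
rewrite mem_filter => /andP[/eqP cm _].
apply: eval_index; first exact: ready_n.
  by rewrite size_mask ?size_tuple // cm.
by rewrite !map_mask eval_digits.
Qed.

Lemma edges_at (u : seq 'I_n) : size u = k ->
  arrs s 1 (tuple_index u) = ([set x in u] \in edges G).
Proof. by move/eqP=> su; apply: (ready_edges s_ready (Tuple su)). Qed.

Lemma size_masks m (T : Type) (u : g.-tuple T) :
  m \in masks g k -> size (mask m u) = k.
Proof.
by rewrite mem_filter => /andP[/eqP cm _]; rewrite size_mask ?size_tuple.
Qed.

Lemma set_map_part (u : seq 'I_n) :
  [set c in map part u] = part @: [set x in u].
Proof.
apply/setP=> c; rewrite inE; apply/mapP/imsetP => [] [x ux ->]; exists x => //.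
  by rewrite inE.
by rewrite inE in ux.
Qed.

Hypothesis le_gl : g <= l.

Lemma eval_edge_expr : eval b s edge_expr = ([set x in t] \in edges G').
Proof.
rewrite (eval_and b_gt0 (eval_decide b_gt0 _ l_small eval_colours)
  (eval_all b_gt0 (p := fun m : g.-tuple bool => [set x in mask m t] \in edges G) _)).
  congr (nat_of_bool _); rewrite [RHS]inE /arc_clique /arc_colours set_map_part.
  have [upt|nupt] := boolP (uniq (map part t)).
    have ut := map_uniq upt.
    by rewrite all_masks // cardsE (card_uniqP ut) size_tuple eqxx.
  (* A repeated colour makes the left side false. The right side is false too: a colour set that is
     an arc has [g] elements, which leaves no repetition among [g] entries. *)
  apply/esym/negbTE; apply: contra nupt => /and3P[_ /existsP[a /eqP Ea] _].
  apply/card_uniqP; rewrite -cardsE set_map_part Ea card_cyc_arc //.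
  by rewrite size_map size_tuple.
move=> m mm; rewrite -[LHS]/(arrs s 1 (eval b s (EIndex (mask m digits)))).
by rewrite eval_mask_index // edges_at // size_masks.
Qed.

Lemma weval_weight_expr (w : {set 'I_n} -> R) :
  stores_weights (warrs s 0) G w -> [set x in t] \in edges G' ->
  weval b s weight_expr = arc_weight k g part w [set x in t].
Proof.
move=> sw /cycle_edgeP[cS _ cl].
have ut : uniq t by apply/card_uniqP; rewrite -cardsE cS size_tuple.
rewrite /arc_weight big_mkcondr sum_masks //= /weight_expr.
(* This trivial inclusion lets the induction on the list of masks remember that each one is in
   [masks g k]. *)
have : {subset masks g k <= masks g k} by [].
elim: {1 3 4}(masks g k) => [|m r IHr] sub; first by rewrite big_nil.
rewrite big_cons -IHr; last by move=> m' m'r; apply/sub/mem_behead.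
have mm : m \in masks g k by apply/sub/mem_head.
have km := size_masks t mm.
set e1 := EIndex (mask m digits); pose c := EDecide (charged m) colours.
rewrite -[LHS]/(warrs s 0 (eval b s (ESel c e1 (EPow k))) + _)%R; congr (_ + _)%R.
have powE := eval_pow b_gt0 (ready_n s_ready) k_small.
rewrite (eval_sel b_gt0 (eval_decide b_gt0 _ l_small eval_colours)) ?powE //; last first.
  by rewrite eval_mask_index // (leq_trans (tuple_index_lt _)) // km ltnW.
(* A subset charged to another arc reads the zero cell; otherwise its own weight is read, as it is
   an edge of [G]. *)
rewrite /charged -map_mask !set_map_part; case: ifP => _; last exact: ready_zero.
rewrite eval_mask_index //; apply: (sw (Tuple (introT eqP km))) => /=.
apply: cl; first by apply/subsetP=> x; rewrite !inE => /mem_mask.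
by rewrite cardsE (card_uniqP (mask_uniq ut m)).
Qed.

End AtTuple.

(** The weight clauses range over all [w] stored in the initial state [s0], so a single run serves
    both the unweighted and the weighted claim. *)
Record loop_inv (s0 : state R) (i : nat) (s : state R) : Prop := LoopInv {
  inv_ready : ready s;
  inv_counter : vars s 1 = i;
  inv_bound : i <= n ^ g;
  inv_input : forall w, stores_weights (warrs s0 0) G w ->
    stores_weights (warrs s 0) G w;
  inv_edges : forall t : g.-tuple 'I_n, tuple_index t < i ->
    arrs s 2 (tuple_index t) = ([set x in t] \in edges G');
  inv_weights : forall w (t : g.-tuple 'I_n),
    stores_weights (warrs s0 0) G w -> tuple_index t < i ->
    [set x in t] \in edges G' ->
    warrs s 1 (tuple_index t) = arc_weight k g part w [set x in t]
}.

Hypothesis le_gl : g <= l.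

Lemma loop_testE s0 i s : loop_inv s0 i s -> eval b s loop_test = (i < n ^ g).
Proof.
case=> rs Ei _ _ _ _; rewrite (eval_not b_gt0 (x := n ^ g <= i)) -?ltnNge //.
by rewrite -[LHS]/(nat_of_bool (eval b s (EPow g) <= vars s 1)) Ei
  (eval_pow b_gt0 (ready_n rs)).
Qed.

Lemma loop_bodyE s0 i s : i < n ^ g -> loop_inv s0 i s ->
  exists2 s', exec b loop_body s body_cost s' & loop_inv s0 i.+1 s'.
Proof.
move=> lt_i [rs Ei _ sw Es Ew].
pose s1 := set_arr s 2 (vars s 1) (eval b s edge_expr).
pose s2 := set_warr s1 1 (vars s 1) (weval b s1 weight_expr).
have rs1 : ready s1 by case: rs; split.
exists (set_var s2 1 i.+1).
  apply: exec_seq (exec_store _ _ _ _ _) _.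
  apply: exec_seq (exec_wstore _ _ _ _ _) _.
  have -> : i.+1 = eval b s2 (EOp OAdd (EVar 1) (EConst 1)).
    by rewrite /= Ei modnDmr addn1 modn_small // (leq_ltn_trans lt_i).
  exact: exec_assign.
split=> //; first by case: rs; split.
- move=> t; rewrite ltnS leq_eqVlt.
  rewrite -[arrs _ 2]/(upd (arrs s 2) (vars s 1) (eval b s edge_expr)) /upd Ei.
  case: eqP => [Et _|_]; last exact: Es.
  by apply: eval_edge_expr; rewrite ?Ei ?Et.
- move=> w t sw0; rewrite ltnS leq_eqVlt.
  rewrite -[warrs _ 1]/(upd (warrs s 1) (vars s 1) (weval b s1 weight_expr)) /upd Ei.
  case: eqP => [Et _ tG|_]; last exact: Ew.
  by apply: weval_weight_expr tG => //; [rewrite [vars _ 1]Ei Et|apply: sw].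
Qed.

Lemma program_correct s : input G part s ->
  exists2 s', exec b program s (program_time n) s' &
    output G' s' /\
    forall w : {set 'I_n} -> R, stores_weights (warrs s 0) G w ->
      stores_weights (warrs s' 1) G' (arc_weight k g part w).
Proof.
case=> s_n s_part s_edges.
pose s1 := set_var s 1 0; pose s2 := set_warr s1 0 (n ^ k) 0%R.
have inv0 : loop_inv s 0 s2.
  split=> //; first by split=> //=; rewrite /upd /= eqxx.
  (* The cleared cell [n ^ k] lies beyond every index of a [k]-tuple, so the input weights
     survive. *)
  move=> w sw t tG; rewrite /= /upd /= ltn_eqF ?sw //.
  by have := tuple_index_lt t; rewrite size_tuple.
have [s' ex' [_ _ _ _ Es Ew]] := exec_for (@loop_testE s) (@loop_bodyE s) inv0.
have small (t : g.-tuple 'I_n) : tuple_index t < n ^ g.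
  by have := tuple_index_lt t; rewrite size_tuple.
exists s'; last by split=> [t|w sw t tG]; [apply: Es|apply: Ew].
have ex1 : exec b (Assign 1 (EConst 0)) s 2 s1.
  by have := exec_assign b s 1 (EConst 0); rewrite /= mod0n.
have ex2 : exec b (WStore 0 (EPow k) WZero) s1 (ecost (EPow k) + 1).+1 s2.
  by rewrite /s2 -(eval_pow b_gt0 (s := s1) s_n k_small); apply: exec_wstore.
exact: exec_seq ex1 (exec_seq ex2 ex').
Qed.

End Program.

(** With word-length constant [l] there is room for [n ^ k] and [n ^ gamma l k], both exponents
    being below [l]. *)
Lemma small_word (n l b j : nat) : (n + 2) ^ l <= 2 ^ b -> j < l ->
  n ^ j < 2 ^ b.
Proof.
move=> lb lt_jl; apply: leq_trans lb; apply: leq_ltn_trans (_ : (n + 2) ^ j < _).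
  by case: j {lt_jl} => [|j] //; rewrite leq_exp2r // leq_addr.
by rewrite ltn_exp2l // addn2.
Qed.

Theorem theorem3p1 :
  (forall l k : nat, 2 <= k -> k < l ->
    exists (p : cmd) (c : nat) (time : nat -> nat),
      is_bigO time (fun n => n ^ gamma l k) /\
      forall (n : nat) (G : hypergraph 'I_n k) (part : 'I_n -> 'I_l),
      exists G' : hypergraph 'I_n (gamma l k),
      [/\ forall R : zmodType,
            @runs_within R p c n (time n) (input G part) (output G'),
          (exists v : l.-tuple 'I_n, hypercycle G' v) <->
          (exists K : {set 'I_n}, partite_hyperclique G part K)
        & forall (R : realDomainType) (w : {set 'I_n} -> R) (W : R),
            weights_within G w W ->
            exists w' : {set 'I_n} -> R,
            [/\ @runs_within R p c n (time n)
                  (weighted_input G part w) (weighted_output G' w'),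
                forall v : l.-tuple 'I_n, min_hypercycle G' w' v ->
                  min_hyperclique G part w [set x in v] /\
                  hyperclique_weight k w [set x in v] =
                    hypercycle_weight (gamma l k) w' v,
                forall K : {set 'I_n}, min_hyperclique G part w K ->
                  exists v : l.-tuple 'I_n,
                    [/\ [set x in v] = K, min_hypercycle G' w' v
                      & hypercycle_weight (gamma l k) w' v =
                          hyperclique_weight k w K]
              & weights_within G' w' ('C(gamma l k, k)%:R * W)%R]]) /\
  (exists c : nat, forall l k : nat, 2 <= k -> k < l ->
    'C(gamma l k, k) <= c * l ^ k).
Proof.
split=> [l k k_gt1 lt_kl|]; last first.
  (* The constant [1] works: the binomial is at most [gamma l k ^ k], and [gamma l k < l]. *)
  exists 1 => l k k_gt1 lt_kl; rewrite mul1n.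
  apply: leq_trans (bin_le_exp _ _) _; rewrite leq_exp2r; last by lia.
  exact/ltnW/gamma_lt.
set g := gamma l k.
have lt_gl : g < l by apply: gamma_lt.
have g_bounds : 0 < g < l by rewrite lt_gl.
have cover : k * (l - g) < l by apply: mul_sub_gamma_lt.
exists (program l k g), l, (program_time l k g).
split; first exact: program_time_bigO.
move=> n G part.
have run (R : zmodType) b (s : state R) : (n + 2) ^ l <= 2 ^ b -> input G part s ->
    exists2 s', exec b (program l k g) s (program_time l k g n) s' &
      output (cycle_graph g G part) s' /\
      forall w : {set 'I_n} -> R, stores_weights (warrs s 0) G w ->
        stores_weights (warrs s' 1) (cycle_graph g G part) (arc_weight k g part w).
  (* The chain is [l < 2 ^ l <= (n + 2) ^ l <= 2 ^ b]. *)
  move=> lb; have l_small : l < 2 ^ b.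
    apply: leq_trans lb; apply: leq_trans (ltn_expl l (ltnSn 1)) _.
    by rewrite leq_exp2r ?leq_addl //; lia.
  apply: program_correct => //; try exact: small_word lb _; last exact: ltnW.
  by case: b l_small {lb} => //; rewrite expn0; lia.
exists (cycle_graph g G part); split.
- move=> R b s lb s_in; have [s' ex [out _]] := run R b s lb s_in.
  by exists (program_time l k g n), s'.
- split=> [[v hv]|[K /(clique_hypercycle g_bounds)[v _ hv]]]; last by exists v.
  by exists [set x in v]; apply: hypercycle_clique hv.
move=> R w W hw; exists (arc_weight k g part w).
have weightE (v : l.-tuple 'I_n) : hypercycle (cycle_graph g G part) v ->
    hypercycle_weight g (arc_weight k g part w) v = hyperclique_weight k w [set x in v].
  by move=> hv; exact: (hypercycle_weightE g_bounds k_gt1 cover hv w).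
have cliqueP (v : l.-tuple 'I_n) : hypercycle (cycle_graph g G part) v ->
    partite_hyperclique G part [set x in v].
  exact: hypercycle_clique.
split.
- move=> b s lb [s_in sw]; have [s' ex [out outw]] := run R b s lb s_in.
  by exists (program_time l k g n), s'; split=> //; split=> //; apply: outw.
(* Every competing clique is traced by a hypercycle of the same weight, so minimality transfers; the
   converse below is symmetric. *)
- move=> v [hv minv]; split; last by rewrite weightE.
  split; first exact: cliqueP.
  move=> K' /(clique_hypercycle g_bounds)[v' <- hv'].
  by rewrite -!weightE //; apply: minv.
- move=> K [cK minK]; have [v vK hv] := clique_hypercycle g_bounds cK.
  exists v; rewrite weightE // vK; split=> //; split=> // v' hv'.
  by rewrite !weightE // vK; apply/minK/cliqueP.
- exact: arc_weight_within.
Qed.
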